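(* If $T$ is a tree, then $S\cap pend(T)\neq\varnothing$ for every $S\in\Omega(T)$.
   Context: All graphs are finite, simple and undirected. A tree is a connected acyclic graph of order (number of vertices) greater than one. A set of vertices is stable if no two of its vertices are adjacent; a maximum stable set is a stable set of maximum cardinality. $\Omega(G)$ denotes the set of all maximum stable sets of a graph $G$. A vertex $v$ of $G$ is pendant if it has exactly one neighbor in $G$, and $pend(G)$ denotes the set of all pendant vertices of $G$. *)

(* Defs.v *)
From mathcomp Require Import all_boot.

Set Implicit Arguments.
Unset Strict Implicit.
Unset Printing Implicit Defensive.

Record sgraph := SGraph {
  vertex :> finType;
  adj : rel vertex;
  adj_sym : symmetric adj;
  adj_irrefl : irreflexive adj
}.

Section Graph.
Variable G : sgraph.

Definition neighbors (v : G) : {set G} := [set w | adj v w].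

Definition stable (S : {set G}) : bool :=
  [forall x in S, forall y in S, ~~ adj x y].

Definition Omega : {set {set G}} :=
  [set S | stable S & [forall S' : {set G}, stable S' ==> (#|S'| <= #|S|)]].

Definition pend : {set G} := [set v | #|neighbors v| == 1].

Definition connected : Prop := forall x y : G, connect (@adj G) x y.

(* A duplicate-free [cycle] of size 2 is just an edge traversed back and
   forth, so graph cycles are those of size at least 3. *)
Definition acyclic : Prop :=
  forall c : seq G, 2 < size c -> ~ ucycle (@adj G) c.

Definition is_tree : Prop := [/\ connected, acyclic & 1 < #|G|].

End Graph.

(* Main.v *)
Require Import Defs.
From mathcomp Require Import all_boot.

(** Suppose that a maximum stable set [S] of the tree [T] contains no pendant
    vertex; two counts of the complement of [S] then disagree.

    Root [T] at a vertex [r] outside [S] and let [d] be the distance to [r].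
    Since [T] has no cycle, adjacent vertices have different depths
    ([depth_adj_neq]) and a vertex has at most one neighbor above it
    ([parent_uniq]).

    On the one hand, the vertices of even depth and those of odd depth form two
    stable sets that cover [T], so [S] contains at least half of the vertices:
    the complement of [S] is no larger than [S] ([leq_card_setC_Omega]).

    On the other hand, each vertex of [S] differs from [r] and is not pendant,
    so besides its parent it has a child, which lies outside [S] by stability.
    Distinct vertices have distinct children, and none of these is [r].  So the
    complement of [S] has more elements than [S] ([ltn_card_setC]). *)

Section RootedTree.
Set Implicit Arguments.
Unset Strict Implicit.
Variable G : sgraph.
Implicit Types (x y u v w r : G) (d : G -> nat) (S : {set G}).

(** These three properties characterize the distance to [r] in a connected
    graph. *)
Definition is_depth r d : Prop :=
  [/\ d r = 0,
      forall v, v != r -> exists2 u, adj u v & d v = (d u).+1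
    & forall u v, adj u v -> d v <= (d u).+1].

Lemma exists_depth r : connected G -> exists d, is_depth r d.
Proof.
move=> conn.
pose walk v n := [exists p : n.-tuple G, path (@adj G) r p && (last r p == v)].
have walkP v n : reflect (exists p, [/\ path (@adj G) r p, last r p = v
                                      & size p = n]) (walk v n).
  apply: (iffP existsP) => [[p /andP[rp /eqP lp]]|[p [rp lp sp]]].
    by exists p; rewrite size_tuple.
  by exists (tcast sp (in_tuple p)); rewrite val_tcast rp lp eqxx.
have ex_walk v : exists n, walk v n.
  by have /connectP[p rp lp] := conn r v; exists (size p); apply/walkP; exists p.
pose d v := ex_minn (ex_walk v).
have d_min v n : walk v n -> d v <= n by rewrite /d; case: ex_minnP => m _; apply.
have d_walk v : walk v (d v) by rewrite /d; case: ex_minnP.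
exists d; split.
- by apply/eqP; rewrite -leqn0; apply/d_min/walkP; exists [::].
- move=> v v_r; have /walkP[p []] := d_walk v.
  case/lastP: p => [_ /= rv|p w]; first by rewrite -rv eqxx in v_r.
  rewrite rcons_path last_rcons size_rcons => /andP[rp lw] eqw dv; subst w.
  exists (last r p) => //; apply/eqP; rewrite eqn_leq -dv; apply/andP; split.
    have /walkP[q [rq lq sq]] := d_walk (last r p).
    rewrite dv -sq; apply/d_min/walkP; exists (rcons q v).
    by rewrite rcons_path rq lq lw last_rcons size_rcons.
  by rewrite ltnS; apply/d_min/walkP; exists p.
- move=> u v uv; have /walkP[q [rq lq sq]] := d_walk u.
  rewrite -sq; apply/d_min/walkP; exists (rcons q v).
  by rewrite rcons_path rq lq uv last_rcons size_rcons.
Qed.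

(** Ascend from [x] and from [y] until the two branches meet.  The bound on the
    depth of the interior is what keeps the path simple when it is lengthened
    at both ends, and when it is closed into a cycle. *)
Lemma branch_path r d x y : is_depth r d -> x != y -> d x = d y ->
  exists p, [/\ p != [::], path (@adj G) x (rcons p y),
                uniq (x :: rcons p y) & {in p, forall z, d z < d x}].
Proof.
move=> [dr par _]; move dx: (d x) => k.
elim: k x y dx => [|k IHk] x y dx x_y dy.
  have root z : d z = 0 -> z = r.
    by move=> dz; apply/eqP; apply: contraT => /par[u _]; rewrite dz.
  by rewrite (root x) // (root y) // eqxx in x_y.
have parent z : d z = k.+1 -> exists2 u, adj u z & d u = k.
  move=> dz; have /par[u uz] : z != r by apply: contra_eqN dz => /eqP->; rewrite dr.
  by rewrite dz => -[->]; exists u.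
have [x' xx' dx'] := parent x dx; have [y' yy' dy'] := parent y (esym dy).
rewrite adj_sym in xx'.
have [eqxy | x'_y'] := eqVneq x' y'.
  exists [:: x']; split=> //= [|| z]; first by rewrite xx' eqxy yy'.
    rewrite !inE negb_or x_y !andbT; apply/andP; split.
      by apply: contra_eqN dx => /eqP->; rewrite dx' neq_ltn ltnSn.
    by apply: contra_eqN dx' => /eqP->; rewrite -dy neq_ltn ltnSn orbT.
  by rewrite inE => /eqP->; rewrite dx'.
have [p [p0 pp up dp]] := IHk x' y' dx' x'_y' (esym dy').
have low z : z \in x' :: rcons p y' -> d z < k.+1.
  rewrite inE mem_rcons inE => /or3P[/eqP->|/eqP->|/dp /ltnW //].
    by rewrite dx'.
  by rewrite dy'.
have notin z : d z = k.+1 -> z \notin x' :: rcons p y'.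
  by move=> dz; apply: contra_eqN dz => /low; rewrite neq_ltn => ->.
exists (x' :: rcons p y'); split=> //.
  by rewrite rcons_path /= xx' pp last_rcons yy'.
rewrite cons_uniq rcons_uniq up mem_rcons inE negb_or x_y !notin //.
Qed.

(** An edge between two vertices of the same depth would close the path of
    [branch_path] into a cycle. *)
Lemma depth_adj_neq r d x y : acyclic G -> is_depth r d -> adj x y -> d x != d y.
Proof.
move=> acy dP xy; apply/eqP => dxy.
have x_y : x != y by apply: contraTneq xy => ->; rewrite adj_irrefl.
have [p [p0 pp up _]] := branch_path dP x_y dxy.
apply: (acy (x :: rcons p y)); first by rewrite /= size_rcons; case: (p) p0.
by rewrite /ucycle up /= rcons_path pp last_rcons adj_sym xy.
Qed.

(** Two parents of [v] have the same depth, so that [v] would close the path of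
    [branch_path] between them into a cycle; [v] lies below all of that path,
    hence off it. *)
Lemma parent_uniq r d v x y : acyclic G -> is_depth r d ->
  adj v x -> adj v y -> d v = (d x).+1 -> d v = (d y).+1 -> x = y.
Proof.
move=> acy dP vx vy dvx dvy; apply/eqP; apply: contraT => x_y.
have dxy : d x = d y by apply: succn_inj; rewrite -dvx.
have [p [p0 pp up dp]] := branch_path dP x_y dxy.
case: (acy (v :: x :: rcons p y)); first by rewrite /= size_rcons.
rewrite /ucycle /= rcons_path vx pp last_rcons adj_sym vy /=.
move: up => /= ->; rewrite andbT inE mem_rcons inE.
apply: contra_eqN dvx => /or3P[/eqP->|/eqP->|/dp dv].
- by rewrite neq_ltn ltnSn.
- by rewrite dxy neq_ltn ltnSn.
- by rewrite neq_ltn ltnS (ltnW dv).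
Qed.

Lemma adj_depthP r d u v : acyclic G -> is_depth r d -> adj u v ->
  d u = (d v).+1 \/ d v = (d u).+1.
Proof.
move=> acy dP uv; have [_ _ le_d] := dP; have vu := uv; rewrite adj_sym in vu.
have := depth_adj_neq acy dP uv; rewrite neq_ltn => /orP[lt|lt]; [right|left].
  by apply/eqP; rewrite eqn_leq lt le_d.
by apply/eqP; rewrite eqn_leq lt le_d.
Qed.

Lemma stableP S :
  reflect {in S &, forall x y, ~~ adj x y} (stable S).
Proof.
apply: (iffP forall_inP) => [st x y xS yS | st x xS].
  by have /forall_inP := st x xS; apply.
by apply/forall_inP => y yS; apply: st.
Qed.

Lemma stable_parity r d b : acyclic G -> is_depth r d ->
  stable [set v | odd (d v) == b].
Proof.
move=> acy dP; apply/stableP => x y; rewrite !inE => /eqP ox /eqP oy.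
apply/negP => /(adj_depthP acy dP)[] dxy; move: ox oy; rewrite dxy /= => <-.
  by case: odd.
by move/esym; case: odd.
Qed.

(** The two parity classes of [d] are stable, so neither is larger than [S],
    and together they exhaust the graph. *)
Lemma leq_card_setC_Omega r d S : acyclic G -> is_depth r d ->
  S \in Omega G -> #|~: S| <= #|S|.
Proof.
move=> acy dP; rewrite inE => /andP[_ /forallP max].
have half b : #|[set v | odd (d v) == b]| <= #|S|.
  by have /implyP := max [set v | odd (d v) == b]; apply; apply: stable_parity dP.
rewrite -(leq_add2l #|S|) cardsC -(cardsC [set v | odd (d v) == true]).
apply: leq_add => //; apply: leq_trans (half false); apply: subset_leq_card.
by apply/subsetP => v; rewrite !inE; case: odd.
Qed.

(** The vertex [v] has a neighbor above it; not being pendant, it has a second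
    neighbor, which can only be below it. *)
Lemma exists_child r d v : acyclic G -> is_depth r d ->
  v != r -> v \notin pend G -> exists2 w, adj v w & d w = (d v).+1.
Proof.
move=> acy dP v_r; have [_ /(_ v v_r)[u uv dv] _] := dP.
rewrite adj_sym in uv; rewrite inE (cardsD1 u) inE uv add1n eqSS -lt0n.
case/card_gt0P=> w; rewrite !inE => /andP[w_u vw].
exists w => //; have [dvw | //] := adj_depthP acy dP vw.
by rewrite (parent_uniq acy dP vw uv dvw dv) eqxx in w_u.
Qed.

(** Sending each vertex of [S] to one of its children is injective because
    parents are unique; the image lies outside [S] because [S] is stable, and
    it misses [r], which is nobody's child. *)
Lemma ltn_card_setC r d S : acyclic G -> is_depth r d -> stable S ->
  r \notin S -> [disjoint S & pend G] -> #|S| < #|~: S|.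
Proof.
move=> acy dP /stableP st rS dis; have [dr _ _] := dP.
(* The default value is never used on [S], where a child exists. *)
pose child v := odflt v [pick w | adj v w && (d w == (d v).+1)].
have childP v : v \in S -> adj v (child v) /\ d (child v) = (d v).+1.
  move=> vS; have v_r : v != r by apply: contraNneq rS => <-.
  have [w vw dw] := exists_child acy dP v_r (negbT (disjointFr dis vS)).
  rewrite /child; case: pickP => [z /andP[vz /eqP dz] //|/(_ w)].
  by rewrite vw dw eqxx.
have child_inj : {in S &, injective child}.
  move=> x y xS yS eq_xy; have [xc dx] := childP x xS; have [yc dy] := childP y yS.
  rewrite -eq_xy in yc dy; rewrite adj_sym in xc; rewrite adj_sym in yc.
  exact: (parent_uniq acy dP xc yc dx dy).
rewrite -(card_in_imset child_inj); apply: proper_card; apply/properP; split.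
  apply/subsetP => _ /imsetP[v vS ->]; rewrite inE.
  by have [vc _] := childP v vS; apply: contraL vc => cS; apply: st.
exists r; first by rewrite inE.
by apply/imsetP => -[v /childP[_ dc] rc]; rewrite -rc dr in dc.
Qed.

(** A connected graph with two vertices has an edge, and [S] misses an end of
    it. *)
Lemma stable_neqT S : connected G -> 1 < #|G| -> stable S ->
  exists r, r \notin S.
Proof.
move=> conn /card_gt1P[x [y [_ _ x_y]]] /stableP st.
have [d [_ par _]] := exists_depth x conn.
have [|u uy _] := par y; first by rewrite eq_sym.
have [uS | ] := boolP (u \in S); last by exists u.
by exists y; apply: contraL uy => yS; apply: st.
Qed.

End RootedTree.

Theorem corollary2p3 (T : sgraph) (hT : is_tree T) (S : {set T})
  (hS : S \in Omega T) : S :&: pend T != set0.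
Proof.
have [conn acy T_gt1] := hT.
have stS : stable S by move: (hS); rewrite inE => /andP[].
have [r rS] := stable_neqT conn T_gt1 stS.
have [d dP] := exists_depth r conn.
apply/negP; rewrite setI_eq0 => /(ltn_card_setC acy dP stS rS).
by rewrite ltnNge (leq_card_setC_Omega acy dP hS).
Qed.
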